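(* Let $(M,J,g)$ be a $\mathcal{W}_1$-manifold with Norden metric of dimension $2n$ with closed 1-form $\theta^*$, and let $R^0$ be the $(0,4)$ curvature tensor of the natural connection $$\nabla^0_xy=\nabla_xy+\tfrac{1}{2n}\left[\theta(Jy)x-g(x,y)J\Omega\right].$$ Then $R^0$ is conformally invariant: for every conformal transformation $\overline g=e^{2u}g$ with $u$ a pluriharmonic function, $\overline R^{0}=e^{2u}R^0$, where $\overline R^0$ is the $(0,4)$ curvature tensor of the corresponding connection $\overline\nabla^0$ of $(M,J,\overline g)$.
   Context: An almost complex manifold with Norden metric $(M,J,g)$ is a smooth $2n$-dimensional manifold with an almost complex structure $J$ ($J^2=-\mathrm{id}$) and a pseudo-Riemannian metric $g$ with $g(Jx,Jy)=-g(x,y)$. Let $\nabla$ be the Levi-Civita connection of $g$ and $F(x,y,z)=g((\nabla_xJ)y,z)$. The Lie 1-forms are $\theta(x)=g^{ij}F(e_i,e_j,x)$ (for any local basis $\{e_i\}$, $(g^{ij})$ the inverse matrix of $g$) and $\theta^*=\theta\circ J$; the Lie vector $\Omega$ is defined by $\theta(x)=g(x,\Omega)$. $(M,J,g)$ is a $\mathcal{W}_1$-manifold if $$F(x,y,z)=\tfrac{1}{2n}\left[g(x,y)\theta(z)+g(x,Jy)\theta(Jz)+g(x,z)\theta(y)+g(x,Jz)\theta(Jy)\right].$$ A connection $D$ is natural if $DJ=Dg=0$. For a connection $D$, $R^D(x,y)z=D_xD_yz-D_yD_xz-D_{[x,y]}z$. A smooth function $u$ is pluriharmonic if the 1-form $du\circ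 J$ is closed. Bars denote the objects constructed by the same definitions from $\overline g$ in place of $g$: $\overline\nabla$ is the Levi-Civita connection of $\overline g$, $\overline\theta,\overline\Omega$ the Lie 1-form and Lie vector of $(M,J,\overline g)$, and $\overline\nabla^0_xy=\overline\nabla_xy+\frac1{2n}[\overline\theta(Jy)x-\overline g(x,y)J\overline\Omega]$. The $(0,4)$ tensors are $R^0(x,y,z,w)=g(R^0(x,y)z,w)$ and $\overline R^0(x,y,z,w)=\overline g(\overline R^0(x,y)z,w)$. *)

(* Defs.v *)
From HB Require Import structures.
From mathcomp Require Import all_boot all_order all_algebra.
From mathcomp Require Import all_classical all_reals all_analysis.

Set Implicit Arguments.
Unset Strict Implicit.
Unset Printing Implicit Defensive.

Import Order.TTheory GRing.Theory Num.Theory.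
Import numFieldNormedType.Exports.

Local Open Scope classical_set_scope.
Local Open Scope ring_scope.

(** * Smooth functions on open subsets of R^m *)

(* [V] is meant to be open.  As R^m is finite-dimensional, asking that the map
   be differentiable and that every directional derivative be C^k is the same
   as asking that the differential be C^k. *)
Fixpoint Ck (R : realType) (m : nat) (W : normedModType R) (k : nat)
    (V : set 'rV[R]_m) (f : 'rV[R]_m -> W) : Prop :=
  if k is k'.+1 then
    (forall x, V x -> differentiable f x) /\ (forall v, Ck k' V ('D_v f))
  else forall x, V x -> {for x, continuous f}.

Definition Cinf (R : realType) (m : nat) (W : normedModType R)
    (V : set 'rV[R]_m) (f : 'rV[R]_m -> W) : Prop := forall k, Ck k V f.

(** * Smooth manifolds *)

(* [chart i] and [unchart i] are total functions, meaningful only on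
   [chart_dom i] and on its image. *)
Record smoothManifold (R : realType) (m : nat) := SmoothManifold {
  mpoint :> topologicalType;
  chart_index : Type;
  chart_dom : chart_index -> set mpoint;
  chart : chart_index -> mpoint -> 'rV[R]_m;
  unchart : chart_index -> 'rV[R]_m -> mpoint;
  mhausdorff : hausdorff_space mpoint;
  msecond_countable : @second_countable mpoint;
  chart_dom_open : forall i, open (chart_dom i);
  chart_cover : forall p, exists i, chart_dom i p;
  chart_img_open : forall i, open (chart i @` chart_dom i);
  chartK : forall i p, chart_dom i p -> unchart i (chart i p) = p;
  chart_continuous : forall i, {within chart_dom i, continuous (chart i)};
  unchart_continuous :
    forall i, {within chart i @` chart_dom i, continuous (unchart i)};
  chart_smooth : forall i j,
    Cinf (chart i @` (chart_dom i `&` chart_dom j)) (chart j \o unchart i)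
}.

Section Manifold.
Context {R : realType} {m : nat} (M : smoothManifold R m).

Definition smooth_on (U : set M) (f : M -> R) : Prop :=
  forall i : chart_index M,
    Cinf (chart i @` (chart_dom i `&` U)) (f \o unchart i).

Definition smooth_at (p : M) (f : M -> R) : Prop :=
  exists U : set M, [/\ open U, U p & smooth_on U f].

(* A tangent vector acts on functions; see [tangent]. *)
Definition operator : Type := (M -> R) -> R.
HB.instance Definition _ := GRing.Lmodule.on operator.

(* T_p M: the directional derivatives at [p], read in a chart around [p].
   Tangent vectors act on functions that are smooth near [p]; giving them the
   value 0 on all other functions makes equality of tangent vectors Leibniz
   equality, and T_p M a linear subspace of [operator]. *)
Definition tangent (p : M) : set operator :=
  [set v | exists i (a : 'rV[R]_m), chart_dom i p /\
     v = fun f => if `[< smooth_at p f >]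
                  then 'D_a (f \o unchart i) (chart i p) else 0].

(* Sections that need not be smooth, nor even tangent; tensors are likewise
   given on all of [operator] but only meaningful on tangent vectors. *)
Definition section : Type := M -> operator.
Definition endo : Type := M -> operator -> operator.
Definition form1 : Type := M -> operator -> R.
Definition form2 : Type := M -> operator -> operator -> R.

Definition app_endo (A : endo) (X : section) : section := fun p => A p (X p).
Definition app_form1 (a : form1) (X : section) : M -> R := fun p => a p (X p).
Definition app_form2 (b : form2) (X Y : section) : M -> R :=
  fun p => b p (X p) (Y p).
Definition act (X : section) (f : M -> R) : M -> R := fun p => X p f.

Definition vector_field (U : set M) (X : section) : Prop :=
  (forall p, U p -> tangent p (X p)) /\
  (forall (V : set M) f, open V -> V `<=` U ->
     smooth_on V f -> smooth_on V (act X f)).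

Definition bracket (X Y : section) : section := fun p f =>
  if `[< smooth_at p f >] then X p (act Y f) - Y p (act X f) else 0.

(** ** Tensor fields *)

Definition smooth_form1 (a : form1) : Prop :=
  (forall p (c : R) x y, tangent p x -> tangent p y ->
     a p (c *: x + y) = c * a p x + a p y) /\
  (forall U X, open U -> vector_field U X -> smooth_on U (app_form1 a X)).

(* d a (X, Y) = X (a Y) - Y (a X) - a [X, Y] *)
Definition closed_form1 (a : form1) : Prop :=
  forall U X Y, open U -> vector_field U X -> vector_field U Y ->
  forall p, U p ->
    X p (app_form1 a Y) - Y p (app_form1 a X) - a p (bracket X Y p) = 0.

Definition differential (u : M -> R) : form1 := fun _ x => x u.

Definition form1_endo (a : form1) (A : endo) : form1 := fun p x => a p (A p x).

Definition smooth_endo (A : endo) : Prop :=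
  [/\ forall p x, tangent p x -> tangent p (A p x),
      forall p (c : R) x y, tangent p x -> tangent p y ->
        A p (c *: x + y) = c *: A p x + A p y
    & forall U X, open U -> vector_field U X -> vector_field U (app_endo A X)].

Definition almost_complex (J : endo) : Prop :=
  smooth_endo J /\ (forall p x, tangent p x -> J p (J p x) = - x).

Definition pseudo_riemannian (g : form2) : Prop :=
  [/\ forall p x y, tangent p x -> tangent p y -> g p x y = g p y x,
      forall p (c : R) x y z, tangent p x -> tangent p y -> tangent p z ->
        g p (c *: x + y) z = c * g p x z + g p y z,
      forall p x, tangent p x ->
        (forall y, tangent p y -> g p x y = 0) -> x = 0
    & forall U X Y, open U -> vector_field U X -> vector_field U Y ->
        smooth_on U (app_form2 g X Y)].

Definition norden (J : endo) (g : form2) : Prop :=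
  forall p x y, tangent p x -> tangent p y -> g p (J p x) (J p y) = - g p x y.

(** ** Connections *)

(* A connection differentiates vector fields defined on any open set, so that
   it may be evaluated on local frames; the axioms are required over every
   open [U], and they force D X Y at p to depend only on X and Y near p. *)
Definition connection : Type := section -> section -> section.

Record is_connection (D : connection) : Prop := IsConnection {
  conn_field : forall U X Y, open U -> vector_field U X -> vector_field U Y ->
    vector_field U (D X Y);
  conn_addl : forall U X X' Y, open U ->
    vector_field U X -> vector_field U X' -> vector_field U Y ->
    forall p, U p -> D (fun q => X q + X' q) Y p = D X Y p + D X' Y p;
  conn_scalel : forall U f X Y, open U ->
    smooth_on U f -> vector_field U X -> vector_field U Y ->
    forall p, U p -> D (fun q => f q *: X q) Y p = f p *: D X Y p;
  conn_addr : forall U X Y Y', open U ->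
    vector_field U X -> vector_field U Y -> vector_field U Y' ->
    forall p, U p -> D X (fun q => Y q + Y' q) p = D X Y p + D X Y' p;
  conn_leibniz : forall U f X Y, open U ->
    smooth_on U f -> vector_field U X -> vector_field U Y ->
    forall p, U p -> D X (fun q => f q *: Y q) p = X p f *: Y p + f p *: D X Y p
}.

Definition torsion_free (D : connection) : Prop :=
  forall U X Y, open U -> vector_field U X -> vector_field U Y ->
  forall p, U p -> D X Y p - D Y X p = bracket X Y p.

Definition metric_connection (g : form2) (D : connection) : Prop :=
  forall U X Y Z, open U ->
    vector_field U X -> vector_field U Y -> vector_field U Z ->
  forall p, U p ->
    X p (app_form2 g Y Z) = g p (D X Y p) (Z p) + g p (Y p) (D X Z p).

Definition levi_civita (g : form2) (D : connection) : Prop :=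
  [/\ is_connection D, torsion_free D & metric_connection g D].

Definition curvature (D : connection) (X Y Z : section) : section := fun p =>
  D X (D Y Z) p - D Y (D X Z) p - D (bracket X Y) Z p.

Definition curvature04 (g : form2) (D : connection) (X Y Z W : section) :
    M -> R := app_form2 g (curvature D X Y Z) W.

(** ** Almost complex manifolds with Norden metric *)

(* F (x, y, z) = g ((nabla_x J) y, z) *)
Definition tensorF (J : endo) (g : form2) (nabla : connection)
    (X Y Z : section) : M -> R := fun p =>
  g p (nabla X (app_endo J Y) p - J p (nabla X Y p)) (Z p).

Definition local_frame (U : set M) (E : 'I_m -> section) : Prop :=
  (forall i, vector_field U (E i)) /\
  (forall p v, U p -> tangent p v ->
     exists! c : 'rV[R]_m, v = \sum_i c 0 i *: E i p).

Definition gram (g : form2) (E : 'I_m -> section) (p : M) : 'M[R]_m :=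
  \matrix_(i, j) g p (E i p) (E j p).

Definition lie_form (J : endo) (g : form2) (nabla : connection)
    (theta : form1) : Prop :=
  smooth_form1 theta /\
  (forall U E Z, open U -> local_frame U E -> vector_field U Z ->
   forall p, U p ->
     theta p (Z p) =
     \sum_i \sum_j invmx (gram g E p) i j * tensorF J g nabla (E i) (E j) Z p).

Definition lie_vector (g : form2) (theta : form1) (Omega : section) : Prop :=
  vector_field setT Omega /\
  (forall p x, tangent p x -> theta p x = g p x (Omega p)).

(* m plays the role of 2n *)
Definition W1 (J : endo) (g : form2) (nabla : connection) (theta : form1) :
    Prop :=
  forall U X Y Z, open U ->
    vector_field U X -> vector_field U Y -> vector_field U Z ->
  forall p, U p ->
    tensorF J g nabla X Y Z p =
    m%:R^-1 * (g p (X p) (Y p) * theta p (Z p)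
             + g p (X p) (J p (Y p)) * theta p (J p (Z p))
             + g p (X p) (Z p) * theta p (Y p)
             + g p (X p) (J p (Z p)) * theta p (J p (Y p))).

Definition connection0 (J : endo) (g : form2) (nabla : connection)
    (theta : form1) (Omega : section) : connection := fun X Y p =>
  nabla X Y p + m%:R^-1 *: (theta p (J p (Y p)) *: X p
                            - g p (X p) (Y p) *: J p (Omega p)).

Definition pluriharmonic (J : endo) (u : M -> R) : Prop :=
  smooth_on setT u /\ closed_form1 (form1_endo (differential u) J).

Definition conformal (u : M -> R) (g : form2) : form2 :=
  fun p x y => expR (2 * u p) * g p x y.

End Manifold.

(* Main.v *)
Require Import Defs.
From mathcomp Require Import all_boot all_order all_algebra.
From mathcomp Require Import all_classical all_reals all_analysis.
From mathcomp Require Import ring lra.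

Set Implicit Arguments.
Unset Strict Implicit.
Unset Printing Implicit Defensive.

Import Order.TTheory GRing.Theory Num.Theory.
Import numFieldNormedType.Exports.

Local Open Scope classical_set_scope.
Local Open Scope ring_scope.

(** For [gb = e^(2u) g], Koszul's formula gives
      [nablab_x y = nabla_x y + du(x) y + du(y) x - g(x,y) grad u].
    Tracing the resulting formula for [F] over a frame, with [tr J = 0], yields
    [thetab = theta + 2n du o J], hence [e^(2u) J Omegab = J Omega - 2n grad u].
    In [nablab^0] the terms [du(y) x] and [g(x,y) grad u] cancel, which leaves
      [nablab^0_x y = nabla^0_x y + du(x) y],
    and the curvature changes by the multiple [d (du) = 0] of the identity. *)

(** * Calculus of [Ck] maps *)

Section SmoothMaps.
Context {R : realType}.

(** The invariance holds already for the curvature with values in vectors, so the factor [e^(2u)]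
    comes only from lowering the last index with [gb]. The coefficient [1/2n] in [nabla^0] is
    matched to the change of [theta]: of the four correction terms in the trace of [F], two give
    [du(J z)] with opposite signs, one is a multiple of [tr J], and the last gives [2n du(J z)],
    because the trace of the identity is [2n]. The vector field [grad u] is never constructed:
    nondegeneracy of [g] reduces each identity of vectors to products with a tangent vector [z],
    where [grad u] is read as [du(z)]. The formal obstacle is locality. Connections take total
    sections, while vector fields are controlled only on open sets, so identities valid on [U] must
    be moved under a connection, and a vector at one point must be extended to a local field before
    the axioms apply to it. *)

Lemma near_eq_continuous (T U : topologicalType) (f g : T -> U) (x : T) :
  (\near x, f x = g x) -> {for x, continuous f} -> {for x, continuous g}.
Proof.
move=> fg fc; have : f @ x --> f x := fc; have /= fgx := nbhs_singleton fg.
rewrite fgx; apply: cvg_trans; apply: near_eq_cvg.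
by apply: filterS fg => y /esym.
Qed.

(** The difference [h = g - f] vanishes near [x], so it has an expansion with zero linear part;
    uniqueness of the differential makes [h] differentiable, and [g = f + h]. *)
Lemma near_eq_differentiable (V W : normedModType R) (f g : V -> W) (x : V) :
  (\near x, f x = g x) -> differentiable f x -> differentiable g x.
Proof.
move=> fg df; pose h y := g y - f y.
have h0 : \near x, h x = 0.
  by apply: filterS fg => y fgy; rewrite /h fgy subrr.
have hd : differentiable h x.
  have hE : h \o shift x = cst (h x) + \0 +o_ 0 id.
    apply/eqaddoE; rewrite addr0 (nbhs_singleton h0).
    rewrite (_ : cst 0 = 0 :> (V -> W)) // add0r.
    apply: eqoE; apply/eqoP => e e0.
    near=> y; rewrite /=.
    suff -> : h (y + x) = 0 by rewrite normr0 mulr_ge0// ltW.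
    near: y; have := h0; rewrite (near_shift 0 x) /=.
    by apply: filterS => y; rewrite /= subr0.
  apply/diff_locallyP; rewrite (diff_unique _ hE); last exact: cst_continuous.
  by split => //; exact: cst_continuous.
rewrite (_ : g = f + h); first exact: differentiableD.
by apply/funext => y; rewrite fctE /h addrC subrK.
Unshelve. all: by end_near. Qed.

Lemma differentiable_row (V : normedModType R) n (f : V -> 'rV[R]_n) x i :
  differentiable f x -> differentiable (fun y => f y 0 i) x.
Proof.
move=> df; exact: (differentiable_comp df (differentiable_coord _ _ _)).
Qed.

Lemma derive_row (V : normedModType R) n (f : V -> 'rV[R]_n) x v i :
  differentiable f x -> 'D_v (fun y => f y 0 i) x = ('D_v f x) 0 i.
Proof.
move=> df.
have /cvg_ex[/= l fl] := diff_derivable (v:=v) df.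
have -> : 'D_v f x = l by apply: cvg_lim fl.
apply: cvg_lim => //.
apply: cvg_trans (cvg_comp _ _ fl (@coord_continuous _ _ _ 0 i l)).
by apply: near_eq_cvg; near=> y; rewrite /= !mxE.
Unshelve. all: by end_near. Qed.

Lemma diff_row n (W : normedModType R) (f : 'rV[R]_n -> W) x v :
  'd f x v = \sum_i v 0 i *: 'd f x (delta_mx 0 i).
Proof.
rewrite [in LHS](row_sum_delta v) linear_sum.
by under eq_bigr do rewrite linearZ.
Qed.

(** The direction of differentiation of [g] varies with the point. Expanding it in the standard
    basis leaves fixed directions with scalar coefficients, the form on which the induction for
    [Ck_comp] closes. *)
Lemma derive_comp_row (V : normedModType R) n (W : normedModType R)
    (f : V -> 'rV[R]_n) (g : 'rV[R]_n -> W) x v :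
  differentiable f x -> differentiable g (f x) ->
  'D_v (g \o f) x = \sum_i ('D_v f x) 0 i *: 'D_(delta_mx 0 i) g (f x).
Proof.
move=> df dg; rewrite deriveE; last exact: differentiable_comp.
rewrite diff_comp //= -(deriveE v df) diff_row.
by apply: eq_bigr => i _; rewrite (deriveE _ dg).
Qed.

Lemma differentiable_expR (y : R) : differentiable expR y.
Proof. exact/derivable1_diffP/derivable_expR. Qed.

Lemma derive_comp_expR (V : normedModType R) (f : V -> R) x v :
  differentiable f x -> 'D_v (expR \o f) x = expR (f x) * 'D_v f x.
Proof.
move=> fd; have ed := differentiable_expR (f x).
rewrite (deriveE v (differentiable_comp fd ed)) (deriveE v fd).
rewrite (diff_comp fd ed) /= (diff1E ed) derive1E mulrC.
apply: (congr1 (fun z : R => 'd f x v * z)).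
exact: (congr1 (fun h => h (f x)) (derive_expR R)).
Qed.

(** * Closure properties of the classes [Ck] *)

Section Ck.
Context {m : nat}.
Implicit Types (V : set 'rV[R]_m).

Lemma sub_Ck (W : normedModType R) k V V' (f : 'rV[R]_m -> W) :
  V' `<=` V -> Ck k V f -> Ck k V' f.
Proof.
move=> VV'; elim: k f => [|k IH] f /=; first by move=> + x /VV'; apply.
by move=> [fd fk]; split => [x /VV'/fd//|v]; exact/IH.
Qed.

Lemma Ck_continuous (W : normedModType R) k V (f : 'rV[R]_m -> W) :
  Ck k V f -> Ck 0 V f.
Proof.
case: k => [//|k] [fd _] x Vx /=; exact/differentiable_continuous/fd.
Qed.

Lemma CkW (W : normedModType R) k V (f : 'rV[R]_m -> W) :
  Ck k.+1 V f -> Ck k V f.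
Proof.
elim: k f => [|k IH] f; first exact: Ck_continuous.
by move=> [fd fk]; split => // v; exact/IH.
Qed.

(** Derivatives see a neighbourhood of the point; openness of [V] turns equality on [V] into
    equality near each of its points. This lets a derivative be replaced by a formula valid on [V]
    only. *)
Lemma eq_Ck (W : normedModType R) k V (f g : 'rV[R]_m -> W) :
  open V -> (forall x, V x -> f x = g x) -> Ck k V f -> Ck k V g.
Proof.
move=> oV.
have nfg (W' : normedModType R) (h l : 'rV[R]_m -> W') x :
    (forall x, V x -> h x = l x) -> V x -> \near x, h x = l x.
  by move=> hl Vx; near=> y; apply: hl; near: y; exact: open_nbhs_nbhs.
elim: k f g => [|k IH] f g fg.
  by move=> fc x Vx; apply: near_eq_continuous (fc x Vx); exact: nfg.
move=> [fd fk]; split=> [x Vx|v].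
  by apply: near_eq_differentiable (fd x Vx); exact: nfg.
by apply: IH (fk v) => x Vx; apply: near_eq_derive; exact: nfg.
Unshelve. all: by end_near. Qed.

Lemma Ck_cst (W : normedModType R) k V (c : W) : Ck k V (cst c : 'rV[R]_m -> W).
Proof.
elim: k c => [|k IH] c; first by move=> x _; exact: cst_continuous.
split=> [x _|v]; first exact: differentiable_cst.
rewrite (_ : 'D_v _ = cst 0); first exact: IH.
by apply/funext => x; rewrite derive_cst.
Qed.

Lemma CkD (W : normedModType R) k V (f g : 'rV[R]_m -> W) : open V ->
  Ck k V f -> Ck k V g -> Ck k V (fun x => f x + g x).
Proof.
move=> oV; elim: k f g => [|k IH] f g.
  by move=> fc gc x Vx; apply: continuousD; [exact: fc|exact: gc].
move=> [fd fk] [gd gk]; split=> [x Vx|v].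
  by apply: differentiableD; [exact: fd|exact: gd].
apply: eq_Ck (IH _ _ (fk v) (gk v)) => // x Vx.
by rewrite -deriveD//; apply: diff_derivable; [exact: fd|exact: gd].
Qed.

Lemma CkM k V (f g : 'rV[R]_m -> R) : open V ->
  Ck k V f -> Ck k V g -> Ck k V (fun x => f x * g x).
Proof.
move=> oV; elim: k f g => [|k IH] f g.
  by move=> fc gc x Vx; apply: continuousM; [exact: fc|exact: gc].
move=> fk1 gk1; have [fd fk] := fk1; have [gd gk] := gk1.
split=> [x Vx|v]; first by apply: differentiableM; [exact: fd|exact: gd].
apply: eq_Ck (CkD oV (IH _ _ (CkW fk1) (gk v)) (IH _ _ (CkW gk1) (fk v))) => //.
move=> x Vx; rewrite -[RHS]/('D_v (f * g) x) deriveM //.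
  by apply: diff_derivable; exact: fd.
by apply: diff_derivable; exact: gd.
Qed.

Lemma Ck_sum (I : Type) (r : seq I) k V (f : I -> 'rV[R]_m -> R) : open V ->
  (forall i, Ck k V (f i)) -> Ck k V (fun x => \sum_(i <- r) f i x).
Proof.
move=> oV fk; elim: r => [|i r IH].
  by apply: eq_Ck (Ck_cst k V 0) => // x _; rewrite big_nil.
by apply: eq_Ck (CkD oV (fk i) IH) => // x _; rewrite big_cons.
Qed.

Lemma Ck_row k V n (f : 'rV[R]_m -> 'rV[R]_n) i : open V ->
  Ck k V f -> Ck k V (fun x => f x 0 i).
Proof.
move=> oV; elim: k f => [|k IH] f.
  move=> fc x Vx.
  apply: (@continuous_comp _ _ _ f (fun M : 'rV[R]_n => M 0 i) x (fc x Vx)).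
  exact: coord_continuous.
move=> [fd fk]; split=> [x Vx|v]; first exact/differentiable_row/fd.
by apply: eq_Ck (IH _ (fk v)) => // x Vx; rewrite derive_row //; exact: fd.
Qed.

Lemma Ck_expR k V (f : 'rV[R]_m -> R) : open V ->
  Ck k V f -> Ck k V (fun x => expR (f x)).
Proof.
move=> oV; elim: k f => [|k IH] f.
  by move=> fc x Vx; apply: continuous_comp; [exact: fc|exact: continuous_expR].
move=> fk1; have [fd fk] := fk1.
split=> [x Vx|v].
  by apply: differentiable_comp; [exact: fd|exact: differentiable_expR].
apply: eq_Ck (CkM oV (IH _ (CkW fk1)) (fk v)) => // x Vx.
by rewrite -(derive_comp_expR v (fd x Vx)).
Qed.

End Ck.

Lemma Ck_comp m n k V V' (f : 'rV[R]_m -> 'rV[R]_n) (g : 'rV[R]_n -> R) :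
  open V -> f @` V `<=` V' -> Ck k V f -> Ck k V' g -> Ck k V (g \o f).
Proof.
move=> oV fV; have {}fV x : V x -> V' (f x) by move=> Vx; apply: fV; exists x.
elim: k f g fV => [|k IH] f g fV.
  by move=> fc gc x Vx; apply: continuous_comp; [exact: fc|exact/gc/fV].
move=> fk1 [gd gk]; have [fd fk] := fk1; split=> [x Vx|v].
  by apply: differentiable_comp; [exact: fd|exact/gd/fV].
apply: (eq_Ck (f := fun x => \sum_i
   ('D_v f x) 0 i * ('D_(delta_mx 0 i) g \o f) x)) => //.
  by move=> x Vx; rewrite (derive_comp_row v (fd x Vx) (gd _ (fV x Vx))).
apply: Ck_sum => // i; apply: CkM => //; first exact: Ck_row (fk v).
exact: IH fV (CkW fk1) (gk _).
Qed.

End SmoothMaps.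

(** * Tangent vectors and vector fields *)

Section Manifold.
Context {R : realType} {m : nat} {M : smoothManifold R m}.
Implicit Types (p q : M) (U V : set M) (f h : M -> R) (X Y Z : section M).
Implicit Types (v w : operator M).

(** Inside the open image of the chart this set is the preimage of [U] under the continuous map
    [unchart i]. *)
Lemma open_chart_img (i : chart_index M) U : open U ->
  open (chart i @` (chart_dom i `&` U)).
Proof.
move=> oU; have oi := @chart_img_open _ _ M i.
have := @unchart_continuous _ _ M i.
rewrite continuous_open_subspace // => /(continuous_inP _ oi)/(_ U oU).
congr open; apply/seteqP; split => [_ /= [[q dq <-]]|_ /= [q [dq Uq] <-]].
  by rewrite chartK // => Uq; exists q.
by rewrite chartK //; split => //; exists q.
Qed.

Lemma sub_smooth_on U V f : V `<=` U -> smooth_on U f -> smooth_on V f.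
Proof.
move=> VU fs i k; apply: sub_Ck (fs i k).
by apply: image_subset; apply: setIS.
Qed.

Lemma eq_smooth_on U f h : open U -> (forall q, U q -> f q = h q) ->
  smooth_on U f -> smooth_on U h.
Proof.
move=> oU fh fs i k; apply: eq_Ck (fs i k); first exact: open_chart_img.
by move=> _ [q [dq Uq] <-] /=; rewrite chartK // fh.
Qed.

Lemma smooth_on_cst U (c : R) : smooth_on U (cst c : M -> R).
Proof. by move=> i k; exact: Ck_cst. Qed.

Lemma smooth_onD U f h : open U -> smooth_on U f -> smooth_on U h ->
  smooth_on U (fun q => f q + h q).
Proof.
by move=> oU fs hs i k; apply: CkD (fs i k) (hs i k); exact: open_chart_img.
Qed.

Lemma smooth_onM U f h : open U -> smooth_on U f -> smooth_on U h ->
  smooth_on U (fun q => f q * h q).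
Proof.
by move=> oU fs hs i k; apply: CkM (fs i k) (hs i k); exact: open_chart_img.
Qed.

Lemma smooth_on_expR U f : open U -> smooth_on U f ->
  smooth_on U (fun q => expR (f q)).
Proof. by move=> oU fs i k; apply: Ck_expR (fs i k); exact: open_chart_img. Qed.

Lemma smooth_on_chart (i : chart_index M) j :
  smooth_on (chart_dom i) (fun q => chart i q 0 j).
Proof.
move=> l k; apply: (Ck_row (f := chart i \o unchart l)).
  exact/open_chart_img/chart_dom_open.
exact: chart_smooth.
Qed.

Lemma smooth_on_at U f p : open U -> U p -> smooth_on U f -> smooth_at p f.
Proof. by exists U. Qed.

Lemma smooth_at_differentiable p f i : chart_dom i p -> smooth_at p f ->
  differentiable (f \o unchart i) (chart i p).
Proof. by move=> dp [U [oU Up /(_ i 1%N)[fd _]]]; apply: fd; exists p. Qed.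

Lemma smooth_at2 p f h : smooth_at p f -> smooth_at p h ->
  exists U, [/\ open U, U p, smooth_on U f & smooth_on U h].
Proof.
move=> [U [oU Up fs]] [V [oV Vp hs]]; exists (U `&` V); split.
- exact: openI.
- by [].
- by apply: sub_smooth_on fs => ? [].
- by apply: sub_smooth_on hs => ? [].
Qed.

Lemma smooth_atM p f h : smooth_at p f -> smooth_at p h ->
  smooth_at p (fun q => f q * h q).
Proof.
move=> fs hs; have [U [oU Up fU hU]] := smooth_at2 fs hs.
by exists U; split => //; exact: smooth_onM.
Qed.

(** The coordinate field with constant components [a], in exactly the form required by [tangent],
    including the value 0 on functions that are not smooth at [p]. *)
Definition chart_vector (i : chart_index M) (a : 'rV[R]_m) : section M :=
  fun p f => if `[< smooth_at p f >] then 'D_a (f \o unchart i) (chart i p)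
             else 0.

Lemma chart_vectorE i a p f : smooth_at p f ->
  chart_vector i a p f = 'D_a (f \o unchart i) (chart i p).
Proof. by rewrite /chart_vector => /asboolT ->. Qed.

Lemma chart_vector_tangent i a p : chart_dom i p ->
  tangent p (chart_vector i a p).
Proof. by move=> dp; exists i, a. Qed.

Lemma chart_vectorD i (c : R) a b p : chart_dom i p ->
  chart_vector i (c *: a + b) p =
  c *: chart_vector i a p + chart_vector i b p.
Proof.
move=> dp; apply/funext => f.
rewrite -[RHS]/(c * chart_vector i a p f + chart_vector i b p f).
have [fs|/asboolPn nfs] := pselect (smooth_at p f); last first.
  by rewrite /chart_vector (negbTE nfs) mulr0 addr0.
have fd := smooth_at_differentiable dp fs.
by rewrite !chart_vectorE // !deriveE // linearP.
Qed.

Lemma chart_vector_sum i a p : chart_dom i p ->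
  chart_vector i a p = \sum_j a 0 j *: chart_vector i (delta_mx 0 j) p.
Proof.
move=> dp; pose L b := chart_vector i b p.
have LZD c b b' : L (c *: b + b') = c *: L b + L b' by exact: chart_vectorD.
have L0 : L 0 = 0.
  apply: (addIr (L 0)); rewrite add0r -{1}[L 0]scale1r -LZD.
  by rewrite scaler0 addr0.
rewrite -/(L a) [in LHS](row_sum_delta a).
elim: (index_enum _) => [|j r IH]; first by rewrite !big_nil.
by rewrite !big_cons LZD IH.
Qed.

Lemma transition_differentiable i j p : chart_dom i p -> chart_dom j p ->
  differentiable (chart j \o unchart i) (chart i p).
Proof.
move=> di dj; have [fd _] := @chart_smooth _ _ M i j 1%N.
by apply: fd; exists p.
Qed.

Lemma near_transition i j f p : chart_dom i p -> chart_dom j p ->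
  \forall x \near chart i p,
    (f \o unchart j \o (chart j \o unchart i)) x = (f \o unchart i) x.
Proof.
move=> di dj; have oD := open_chart_img (i:=i) (@chart_dom_open _ _ M j).
have : nbhs (chart i p) (chart i @` (chart_dom i `&` chart_dom j)).
  by apply: open_nbhs_nbhs; split => //; exists p.
by apply: filterS => _ [q [diq djq] <-] /=; rewrite !chartK.
Qed.

(** The chain rule: components transform by the differential of the transition map. Hence all of the
    tangent space at [p] can be read in one chart, which makes it a linear subspace. *)
Lemma chart_vector_change i j a p : chart_dom i p -> chart_dom j p ->
  chart_vector i a p =
  chart_vector j ('D_a (chart j \o unchart i) (chart i p)) p.
Proof.
move=> di dj; apply/funext => f.
have [fs|/asboolPn nfs] := pselect (smooth_at p f); last first.
  by rewrite /chart_vector (negbTE nfs).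
rewrite !chart_vectorE // -(near_eq_derive _ (near_transition f di dj)).
have td := transition_differentiable di dj.
have fd := smooth_at_differentiable dj fs.
have ji : (chart j \o unchart i) (chart i p) = chart j p by rewrite /= chartK.
have fd' : differentiable (f \o unchart j) ((chart j \o unchart i) (chart i p)).
  by rewrite ji.
rewrite (deriveE a (differentiable_comp td fd')) (diff_comp td fd') ji.
by rewrite /= -(deriveE a td) -(deriveE _ fd).
Qed.

Lemma tangent_chart i p v : chart_dom i p -> tangent p v ->
  exists a, v = chart_vector i a p.
Proof.
move=> di [j [a [dj ->]]]; rewrite -/(chart_vector j a p).
by rewrite (chart_vector_change a dj di); eexists.
Qed.

Lemma tangentP p (c : R) v w : tangent p v -> tangent p w ->
  tangent p (c *: v + w).
Proof.
have [i di] := chart_cover p.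
move=> /(tangent_chart di)[a ->] /(tangent_chart di)[b ->].
by rewrite -chart_vectorD //; exact: chart_vector_tangent.
Qed.

Lemma tangent0 p : tangent p 0.
Proof.
have [i di] := chart_cover p; have t0 := chart_vector_tangent 0 di.
by rewrite -(addNr (chart_vector i 0 p)) -scaleN1r; exact: tangentP.
Qed.

Lemma tangentD p v w : tangent p v -> tangent p w -> tangent p (v + w).
Proof. by rewrite -{2}[v]scale1r; exact: tangentP. Qed.

Lemma tangentZ p (c : R) v : tangent p v -> tangent p (c *: v).
Proof. by move=> tv; rewrite -[_ *: _]addr0; apply/tangentP/tangent0. Qed.

Lemma tangentB p v w : tangent p v -> tangent p w -> tangent p (v - w).
Proof. by move=> tv tw; rewrite -scaleN1r addrC; exact: tangentP. Qed.

Lemma tangentM p v f h : tangent p v -> smooth_at p f -> smooth_at p h ->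
  v (fun q => f q * h q) = v f * h p + f p * v h.
Proof.
have [i di] := chart_cover p; move=> /(tangent_chart di)[a ->] fs hs.
rewrite !chart_vectorE //; last exact: smooth_atM.
have fd := smooth_at_differentiable di fs.
have hd := smooth_at_differentiable di hs.
rewrite -[LHS]/('D_a ((f \o unchart i) * (h \o unchart i)) (chart i p)).
rewrite deriveM; [|exact: diff_derivable..].
by rewrite /= chartK // addrC; congr (_ + _); rewrite mulrC.
Qed.

Lemma tangent_expR p v f : tangent p v -> smooth_at p f ->
  v (fun q => expR (f q)) = expR (f p) * v f.
Proof.
have [i di] := chart_cover p; move=> /(tangent_chart di)[a ->] fs.
rewrite !chart_vectorE //; last first.
  have [U [oU Up fU]] := fs; exists U; split => //; exact: smooth_on_expR.
rewrite -[LHS]/('D_a (expR \o (f \o unchart i)) (chart i p)).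
by rewrite derive_comp_expR ?/= ?chartK //; exact: smooth_at_differentiable.
Qed.

Lemma tangent_cst p v (c : R) : tangent p v -> v (cst c) = 0.
Proof.
have [i di] := chart_cover p; move=> /(tangent_chart di)[a ->].
rewrite chart_vectorE; last first.
  by exists setT; split=> //; [exact: openT|exact: smooth_on_cst].
exact: derive_cst.
Qed.

(** * Vector fields and coordinate frames *)

Lemma sub_vector_field U V X : V `<=` U -> vector_field U X -> vector_field V X.
Proof.
move=> VU [tX sX]; split => [q /VU/tX//|W f oW WV].
by apply: sX => //; exact: subset_trans VU.
Qed.

Lemma eq_vector_field U X Y : open U -> (forall q, U q -> X q = Y q) ->
  vector_field U X -> vector_field U Y.
Proof.
move=> oU XY [tX sX]; split => [q Uq|V f oV VU fV].
  by rewrite -XY //; exact: tX.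
apply: eq_smooth_on (sX V f oV VU fV) => // q /VU Uq.
by rewrite /act XY.
Qed.

Lemma vector_fieldD U X Y : vector_field U X -> vector_field U Y ->
  vector_field U (fun q => X q + Y q).
Proof.
move=> [tX sX] [tY sY]; split => [q Uq|V f oV VU fV].
  by apply: tangentD; [exact: tX|exact: tY].
exact: smooth_onD oV (sX V f oV VU fV) (sY V f oV VU fV).
Qed.

Lemma vector_fieldZ U (f : M -> R) X : smooth_on U f -> vector_field U X ->
  vector_field U (fun q => f q *: X q).
Proof.
move=> fs [tX sX]; split => [q Uq|V h oV VU hV]; first exact/tangentZ/tX.
exact: smooth_onM oV (sub_smooth_on VU fs) (sX V h oV VU hV).
Qed.

Lemma vector_fieldB U X Y : vector_field U X -> vector_field U Y ->
  vector_field U (fun q => X q - Y q).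
Proof.
move=> vX vY; apply: (vector_fieldD vX).
rewrite (_ : (fun q => - Y q) = fun q => (cst (-1) : M -> R) q *: Y q).
  by apply: vector_fieldZ => //; exact: smooth_on_cst.
by apply/funext => q; rewrite scaleN1r.
Qed.

Lemma chart_vector_field i a : vector_field (chart_dom i) (chart_vector i a).
Proof.
split=> [p|V f oV Vi fV]; first exact: chart_vector_tangent.
apply: (eq_smooth_on (f := fun q => 'D_a (f \o unchart i) (chart i q))) => //.
  by move=> q Vq; rewrite /act chart_vectorE //; exact: smooth_on_at fV.
move=> j k; have oj := open_chart_img (i:=j) oV.
(* Read in chart [j], the function is a coordinate derivative in chart [i] composed with the
   transition map; class [k] for it requires class [k.+1] for [f]. *)
apply: (Ck_comp (f := chart i \o unchart j) (g := 'D_a (f \o unchart i))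
   (V' := chart i @` (chart_dom i `&` V))) => //.
- move=> _ [_ [q [dq Vq] <-] <-]; exists q => /=; last by rewrite chartK.
  by split => //; exact: Vi.
- apply: sub_Ck (@chart_smooth _ _ M j i k).
  by apply: image_subset; exact: setIS.
- by have [_] := fV i k.+1; apply.
Qed.

Definition chart_frame (i : chart_index M) (j : 'I_m) : section M :=
  chart_vector i (delta_mx 0 j).

(** Applied to the coordinate functions of the chart, a coordinate vector returns its components. *)
Lemma chart_vector_inj i a b p : chart_dom i p ->
  chart_vector i a p = chart_vector i b p -> a = b.
Proof.
move=> di ab; apply/rowP => j; pose f q := chart i q 0 j.
have fs : smooth_at p f.
  exact: smooth_on_at (@chart_dom_open _ _ M i) di (@smooth_on_chart i j).
suff ev c : chart_vector i c p f = c 0 j by rewrite -!ev ab.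
rewrite chart_vectorE //.
rewrite -(@near_eq_derive _ _ _ (fun x : 'rV[R]_m => x 0 j)).
  by rewrite (derive_row (f := id)) ?derive_id //; exact: ex_diff.
have oD := open_chart_img (i:=i) (@chart_dom_open _ _ M i).
have : nbhs (chart i p) (chart i @` (chart_dom i `&` chart_dom i)).
  by apply: open_nbhs_nbhs; split => //; exists p.
by apply: filterS => _ [q [dq _] <-]; rewrite /f /= chartK.
Qed.

Lemma chart_frame_local_frame i : local_frame (chart_dom i) (chart_frame i).
Proof.
split=> [j|p v di tv]; first exact: chart_vector_field.
have [a va] := tangent_chart di tv.
exists a; split; first by rewrite va; exact: chart_vector_sum.
move=> b vb; apply: (@chart_vector_inj i _ _ p) => //.
by rewrite -va vb; exact/esym/chart_vector_sum.
Qed.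

End Manifold.

(** * Connections *)

Section Connections.
Context {R : realType} {m : nat} {M : smoothManifold R m}.
Implicit Types (p : M) (U V : set M) (X Y Z W : section M) (D : connection M).

(** Connection and metric axioms speak of fields on open sets, nondegeneracy of vectors at a point;
    a field with constant components in a chart links the two. *)
Lemma tangent_extend p (v : operator M) : tangent p v ->
  exists V Z, [/\ open V, V p, vector_field V Z & Z p = v].
Proof.
have [i di] := chart_cover p; move=> /(tangent_chart di)[a ->].
exists (chart_dom i), (chart_vector i a); split => //.
  exact: chart_dom_open.
exact: chart_vector_field.
Qed.

(* Multiplying by the indicator of [U], which is smooth on [U], makes [Y] and
   [Y'] equal everywhere. *)
Lemma connection_eqr D U X Y Y' p : is_connection D -> open U ->
  vector_field U X -> vector_field U Y -> (forall q, U q -> Y q = Y' q) ->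
  U p -> D X Y p = D X Y' p.
Proof.
move=> cD oU vX vY YY' Up.
have s1 : smooth_on U (\1_U : M -> R).
  apply: eq_smooth_on (smooth_on_cst U 1) => // q Uq.
  by rewrite indicE mem_set.
have vY' := eq_vector_field oU YY' vY.
have := conn_leibniz cD oU s1 vX vY' Up; have := conn_leibniz cD oU s1 vX vY Up.
rewrite indicE mem_set // !scale1r -(YY' p Up).
have -> : (fun q => (\1_U q : R) *: Y' q) = fun q => (\1_U q : R) *: Y q.
  apply/funext => q; rewrite indicE.
  by have [/set_mem/YY'->|] := boolP (q \in U); rewrite ?scale0r.
by move=> -> /addrI.
Qed.

(** On [U] the bracket equals [D_X Y - D_Y X], whose smoothness is an axiom of connections; no
    computation with second derivatives in charts is required. *)
Lemma torsion_free_bracket D U X Y : is_connection D -> torsion_free D ->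
  open U -> vector_field U X -> vector_field U Y ->
  vector_field U (bracket X Y).
Proof.
move=> cD tD oU vX vY.
apply: (eq_vector_field (X := fun q => D X Y q - D Y X q)) => //.
  by move=> q Uq; exact: tD oU vX vY q Uq.
by apply: vector_fieldB; exact: conn_field.
Qed.

(* [D'] differs from [D] by the exact scalar 1-form [du], which contributes
   [d (du) = 0] to the curvature. *)
Lemma curvature_add_differential D D' (u : M -> R) :
  is_connection D -> smooth_on setT u ->
  (forall U X Y, open U -> vector_field U X -> vector_field U Y ->
     vector_field U (bracket X Y)) ->
  (forall U X Y, open U -> vector_field U X -> vector_field U Y ->
     forall p, U p -> D' X Y p = D X Y p + X p u *: Y p) ->
  forall U X Y Z, open U ->
    vector_field U X -> vector_field U Y -> vector_field U Z ->
  forall p, U p -> curvature D' X Y Z p = curvature D X Y Z p.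
Proof.
move=> cD us brv D'E U X Y Z oU vX vY vZ p Up.
have second X1 X2 : vector_field U X1 -> vector_field U X2 ->
    D' X1 (D' X2 Z) p = D X1 (D X2 Z) p + X1 p (act X2 u) *: Z p +
      X2 p u *: D X1 Z p + X1 p u *: D X2 Z p + (X1 p u * X2 p u) *: Z p.
  move=> v1 v2.
  have s2 : smooth_on U (act X2 u).
    by apply: (proj2 v2); last exact: sub_smooth_on us.
  have vD := conn_field cD oU v2 vZ.
  have vs := vector_fieldZ s2 vZ.
  have E2 q : U q -> D X2 Z q + act X2 u q *: Z q = D' X2 Z q.
    by move=> Uq; rewrite (D'E U).
  have v2' := eq_vector_field oU E2 (vector_fieldD vD vs).
  (* The formula for [D' X2 Z] holds on [U] only, so locality of [D] is what allows it under
     [D X1]. *)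
  rewrite (D'E U) // -(connection_eqr cD oU v1 (vector_fieldD vD vs) E2 Up).
  rewrite (conn_addr cD oU v1 vD vs Up) (conn_leibniz cD oU s2 v1 vZ Up).
  by rewrite -(E2 p Up) scalerDr scalerA !addrA.
rewrite /curvature !second // (D'E U) //; last exact: brv.
have -> : bracket X Y p u = X p (act Y u) - Y p (act X u).
  by rewrite /bracket asboolT //; exact: smooth_on_at openT I us.
rewrite scalerBl (mulrC (Y p u)).
set a1 := D X _ p; set a2 := D Y (D X Z) p; set a3 := D (bracket X Y) Z p.
set b1 := X p _ *: Z p; set b2 := Y p (act X u) *: Z p.
set c1 := Y p u *: _; set c2 := X p u *: _; set d := (X p u * Y p u) *: _.
rewrite !opprD !opprK !addrA.
(* The terms [c1], [c2], [d] are symmetric under exchange of [X] and [Y]; [b1] and [b2] are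
   cancelled by [[X, Y] u]. *)
have -> : a1 + b1 + c1 + c2 + d - a2 - b2 - c2 - c1 - d - a3 - b1 + b2 =
    a1 - a2 - a3 + ((b1 - b1) + (c1 - c1) + (c2 - c2) + (d - d) + (b2 - b2)).
  rewrite !addrA.
  move: a1 a2 a3 b1 b2 c1 c2 d => a1 a2 a3 b1 b2 c1 c2 d.
  (* Operators form only a module; evaluation at [f] gives an identity of real numbers. *)
  apply/funext => f.
  by rewrite /GRing.add /GRing.opp /=; ring.
by rewrite !subrr !addr0.
Qed.

End Connections.

(** * Metrics and traces over a local frame *)

(* The positive definite [S = A^T A + 1] satisfies [A^T S = - S A]. *)
Lemma mxtrace_sqrN1 (F : realFieldType) m (A : 'M[F]_m) :
  A *m A = - 1%:M -> \tr A = 0.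
Proof.
move=> AA; pose S := A^T *m A + 1%:M.
have AT2 : A^T *m A^T = - 1%:M by rewrite -trmx_mul AA linearN /= trmx1.
have ATS : A^T *m S = - (S *m A).
  rewrite /S mulmxDr mulmxDl mulmx1 mul1mx mulmxA AT2 -mulmxA AA.
  by rewrite mulNmx mul1mx mulmxN mulmx1 opprD opprK addrC.
have S_unit : S \in unitmx.
  rewrite -row_free_unit; apply: inj_row_free => v vS.
  have : (v *m S *m v^T) 0 0 = 0 by rewrite vS mul0mx mxE.
  have -> : v *m S *m v^T = (v *m A^T) *m (v *m A^T)^T + v *m v^T.
    by rewrite /S mulmxDr mulmx1 mulmxDl trmx_mul trmxK !mulmxA.
  rewrite !mxE => /eqP; rewrite paddr_eq0; last 2 first.
  - by apply: sumr_ge0 => j _; rewrite [_^T _ _]mxE -expr2 sqr_ge0.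
  - by apply: sumr_ge0 => j _; rewrite [_^T _ _]mxE -expr2 sqr_ge0.
  move=> /andP[_]; rewrite psumr_eq0; last first.
    by move=> j _; rewrite mxE -expr2 sqr_ge0.
  move=> /allP v0; apply/rowP => j; have := v0 j (mem_index_enum j).
  by rewrite /= mxE -expr2 sqrf_eq0 mxE => /eqP.
(* Since [S] is invertible, the transpose of [A] is conjugate to [-A]. *)
have : \tr A = - \tr A.
  rewrite -{1}mxtrace_tr -[A^T](mulmxK S_unit) ATS mulNmx linearN /=.
  by rewrite mxtrace_mulC mulmxA mulVmx // mul1mx.
lra.
Qed.

Section Metric.
Context {R : realType} {m : nat} {M : smoothManifold R m}.
Implicit Types (p : M) (U V : set M) (X Y Z W : section M) (D : connection M).
Implicit Types (x y z : operator M).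
Context {g : form2 M} (g_met : pseudo_riemannian g).

Lemma metricC p x y : tangent p x -> tangent p y -> g p x y = g p y x.
Proof. by have [+ _ _ _] := g_met; apply. Qed.

Lemma metricPl p c x y z : tangent p x -> tangent p y -> tangent p z ->
  g p (c *: x + y) z = c * g p x z + g p y z.
Proof. by have [_ + _ _] := g_met; apply. Qed.

Lemma metricDl p x y z : tangent p x -> tangent p y -> tangent p z ->
  g p (x + y) z = g p x z + g p y z.
Proof. by move=> tx ty tz; rewrite -{1}[x]scale1r metricPl // mul1r. Qed.

Lemma metricPr p c x y z : tangent p x -> tangent p y -> tangent p z ->
  g p z (c *: x + y) = c * g p z x + g p z y.
Proof.
move=> tx ty tz; rewrite !(metricC tz) //; first exact: metricPl.
exact: tangentP.
Qed.

Lemma metric0l p z : tangent p z -> g p 0 z = 0.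
Proof.
move=> tz; have t0 := tangent0 p; apply: (addIr (g p 0 z)).
by rewrite -metricDl // addr0 add0r.
Qed.

Lemma metricZl p c x z : tangent p x -> tangent p z ->
  g p (c *: x) z = c * g p x z.
Proof.
move=> tx tz; have t0 := tangent0 p.
by rewrite -[c *: x]addr0 metricPl // metric0l // addr0.
Qed.

Lemma metricBl p x y z : tangent p x -> tangent p y -> tangent p z ->
  g p (x - y) z = g p x z - g p y z.
Proof.
by move=> tx ty tz; rewrite addrC -scaleN1r metricPl // mulN1r addrC.
Qed.

Lemma metric_eq p x y : tangent p x -> tangent p y ->
  (forall z, tangent p z -> g p x z = g p y z) -> x = y.
Proof.
move=> tx ty xy; apply/subr0_eq; have [_ _ nd _] := g_met.
apply: (nd p); first exact: tangentB.
by move=> z tz; rewrite metricBl // xy // subrr.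
Qed.

Lemma smooth_metric U X Y : open U -> vector_field U X -> vector_field U Y ->
  smooth_on U (app_form2 g X Y).
Proof. by have [_ _ _] := g_met; apply. Qed.

(* Koszul: the difference [A] of the two connections is symmetric, both being
   torsion-free, and [g (A x y) z + g y (A x z) = 2 du(x) g y z]. *)
Lemma conformal_levi_civita nabla nablab (u : M -> R) :
  levi_civita g nabla -> levi_civita (conformal u g) nablab ->
  smooth_on setT u ->
  forall U X Y Z, open U ->
    vector_field U X -> vector_field U Y -> vector_field U Z ->
  forall p, U p ->
    g p (nablab X Y p) (Z p) = g p (nabla X Y p) (Z p) +
      X p u * g p (Y p) (Z p) + Y p u * g p (X p) (Z p) -
      Z p u * g p (X p) (Y p).
Proof.
move=> [cn tn mn] [cb tb mb] us.
have skew U X Y Z p : open U ->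
    vector_field U X -> vector_field U Y -> vector_field U Z -> U p ->
    g p (nablab X Y p) (Z p) + g p (nablab X Z p) (Y p) =
    g p (nabla X Y p) (Z p) + g p (nabla X Z p) (Y p) +
    2 * X p u * g p (Y p) (Z p).
  move=> oU vX vY vZ Up.
  have tX := vX.1 p Up; have tY := vY.1 p Up; have tZ := vZ.1 p Up.
  have tnZ := (conn_field cn oU vX vZ).1 p Up.
  have tbZ := (conn_field cb oU vX vZ).1 p Up.
  have sg := smooth_metric oU vY vZ.
  have up := smooth_on_at openT (I : setT p) us.
  have c2 : smooth_at p (cst 2 : M -> R).
    by exists setT; split => //; [exact: openT|exact: smooth_on_cst].
  have s2u := smooth_atM c2 up.
  have e2u : smooth_at p (fun q => expR (2 * u q)).
    have [V [oV Vp sV]] := s2u; exists V; split => //.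
    exact: smooth_on_expR.
  have := mb U X Y Z oU vX vY vZ p Up.
  rewrite -[app_form2 _ _ _]/(fun q => expR (2 * u q) * app_form2 g Y Z q).
  rewrite (tangentM tX e2u (smooth_on_at oU Up sg)) (tangent_expR tX s2u).
  rewrite (tangentM tX c2 up) (tangent_cst _ tX) mul0r add0r.
  rewrite (mn U X Y Z oU vX vY vZ p Up) /conformal /app_form2.
  rewrite (metricC tY tnZ) (metricC tY tbZ) => h.
  (* Both metricity equations are now in place; the derivative of [e^(2u)] supplies the term
     [2 du(X) g(Y, Z)], and the common factor is cancelled. *)
  apply: (mulfI (lt0r_neq0 (expR_gt0 (2 * u p)))).
  rewrite mulrDr -h; ring.
have tors U X Y Z p : open U ->
    vector_field U X -> vector_field U Y -> vector_field U Z -> U p ->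
    g p (nablab X Y p) (Z p) - g p (nablab Y X p) (Z p) =
    g p (nabla X Y p) (Z p) - g p (nabla Y X p) (Z p).
  move=> oU vX vY vZ Up; have tZ := vZ.1 p Up.
  rewrite -!metricBl ?(tn U) ?(tb U) //.
  - exact: (conn_field cn oU vX vY).1.
  - exact: (conn_field cn oU vY vX).1.
  - exact: (conn_field cb oU vX vY).1.
  - exact: (conn_field cb oU vY vX).1.
move=> U X Y Z oU vX vY vZ p Up.
have tX := vX.1 p Up; have tY := vY.1 p Up; have tZ := vZ.1 p Up.
(* The cyclic permutations of [skew] and [tors] are six linear equations in the six products of
   [nablab] with the third field; they determine the wanted one. *)
have := skew U X Y Z p oU vX vY vZ Up.
have := skew U Y Z X p oU vY vZ vX Up.
have := skew U Z X Y p oU vZ vX vY Up.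
have := tors U X Y Z p oU vX vY vZ Up.
have := tors U Y Z X p oU vY vZ vX Up.
have := tors U Z X Y p oU vZ vX vY Up.
rewrite ?(metricC tZ tX) ?(metricC tY tX) ?(metricC tZ tY).
lra.
Qed.

End Metric.

(** * Contraction with the inverse Gram matrix *)

Section Frames.
Context {R : realType} {m : nat} {M : smoothManifold R m}.
Context {g : form2 M} (g_met : pseudo_riemannian g).
Context {U : set M} {E : 'I_m -> section M} (E_frame : local_frame U E).
Context {p : M} (Up : U p).
Implicit Types (z : operator M) (alpha : operator M -> R).

Let tE i : tangent p (E i p). Proof. exact: (E_frame.1 i).1. Qed.

Lemma tangent_sum (I : Type) (r : seq I) (c : I -> R) (x : I -> operator M) :
  (forall i, tangent p (x i)) -> tangent p (\sum_(i <- r) c i *: x i).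
Proof.
move=> tx; elim: r => [|i r IH]; first by rewrite big_nil; exact: tangent0.
by rewrite big_cons; apply: tangentP.
Qed.

(** Linearity is available on tangent vectors only, so each partial sum has to be kept tangent. *)
Lemma tangent_linear_sum (V : lmodType R) (alpha : operator M -> V)
    (I : Type) (r : seq I) (c : I -> R) (x : I -> operator M) :
  (forall (b : R) y z, tangent p y -> tangent p z ->
     alpha (b *: y + z) = b *: alpha y + alpha z) ->
  (forall i, tangent p (x i)) ->
  alpha (\sum_(i <- r) c i *: x i) = \sum_(i <- r) c i *: alpha (x i).
Proof.
move=> lin tx; elim: r => [|i r IH].
  rewrite !big_nil; have t0 := tangent0 p; apply: (addIr (alpha 0)).
  by rewrite add0r -{1}[alpha 0]scale1r -lin // scale1r addr0.
by rewrite !big_cons lin ?IH //; exact: tangent_sum.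
Qed.

Lemma tangent_form_sum alpha (c : 'rV[R]_m) :
  (forall (b : R) y z, tangent p y -> tangent p z ->
     alpha (b *: y + z) = b * alpha y + alpha z) ->
  alpha (\sum_i c 0 i *: E i p) = \sum_i c 0 i * alpha (E i p).
Proof. by move=> lin; rewrite (tangent_linear_sum (V := R^o)). Qed.

Lemma frame_inj (a b : 'rV[R]_m) :
  \sum_i a 0 i *: E i p = \sum_i b 0 i *: E i p -> a = b.
Proof.
move=> ab; have ta : tangent p (\sum_i a 0 i *: E i p) by exact: tangent_sum.
have [c [_ uc]] := E_frame.2 p _ Up ta.
by rewrite -(uc a erefl) -(uc b ab).
Qed.

Lemma gram_sym i j : gram g E p i j = gram g E p j i.
Proof. by rewrite !mxE; exact: metricC. Qed.

(** A row in the kernel gives a combination of the frame orthogonal to every tangent vector; it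
    vanishes by nondegeneracy, and so do its coefficients. *)
Lemma gram_unit : gram g E p \in unitmx.
Proof.
rewrite -row_free_unit; apply: inj_row_free => a aG.
apply: frame_inj; rewrite [RHS]big1; last by move=> i _; rewrite mxE scale0r.
set x := \sum_i _; have tx : tangent p x by exact: tangent_sum.
apply: (metric_eq g_met tx (tangent0 p)) => z tz.
have [c [-> _]] := E_frame.2 p z Up tz.
rewrite (metric0l g_met (tangent_sum _ _ tE)).
rewrite (tangent_form_sum (alpha := g p x)) //; last first.
  by move=> b y y' ty ty'; exact: metricPr.
rewrite big1 // => j _.
rewrite (tangent_form_sum (alpha := fun y => g p y (E j p))) //; last first.
  by move=> b y y' ty ty'; exact: metricPl.
have /rowP/(_ j) := aG; rewrite !mxE => h.
rewrite (_ : \sum_i _ = 0) ?mulr0 // -[RHS]h.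
by apply: eq_bigr => i _; rewrite mxE.
Qed.

(** If [z] has components [c], the products of [z] with the frame form the row [c G], and the
    inverse Gram matrix recovers [c]. *)
Lemma contract_form alpha z :
  (forall (b : R) y z, tangent p y -> tangent p z ->
     alpha (b *: y + z) = b * alpha y + alpha z) ->
  tangent p z ->
  \sum_i \sum_j invmx (gram g E p) i j * (alpha (E j p) * g p (E i p) z) =
  alpha z.
Proof.
move=> lin tz; have [c [-> _]] := E_frame.2 p z Up tz.
rewrite (tangent_form_sum c lin); set G := gram g E p.
pose al : 'cV[R]_m := \col_j alpha (E j p).
transitivity ((c *m al) 0 0); last first.
  by rewrite mxE; apply: eq_bigr => j _; rewrite mxE.
rewrite -[c](mulmxK gram_unit) -/G mxE exchange_big; apply: eq_bigr => j _ /=.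
rewrite [al _ _]mxE mxE mulr_suml; apply: eq_bigr => i _.
rewrite (tangent_form_sum (alpha := g p (E i p))); last first.
  by move=> b x y tx ty; exact: metricPr.
rewrite mulmxK; last exact: gram_unit.
rewrite mxE mulrCA mulrC -mulrA mulrCA mulrA; congr (_ * _ * _).
by apply: eq_bigr => k _; rewrite gram_sym mxE.
Qed.

Lemma contract_metric :
  \sum_i \sum_j invmx (gram g E p) i j * g p (E i p) (E j p) = m%:R.
Proof.
rewrite -(mxtrace1 R m) -(mulVmx gram_unit); apply: eq_bigr => i _.
by rewrite mxE; apply: eq_bigr => j _; rewrite gram_sym mxE.
Qed.

(** With [A] the matrix of [J] in the frame, the sum is the trace of [G^-1 A G], hence of [A], and
    [A] squares to [-1]. *)
Lemma contract_almost_complex (J : endo M) : almost_complex J ->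
  \sum_i \sum_j invmx (gram g E p) i j * g p (E i p) (J p (E j p)) = 0.
Proof.
move=> [[tJ linJ _] JJ]; set G := gram g E p.
have /choice[a aE] j : exists c : 'rV_m, J p (E j p) = \sum_k c 0 k *: E k p.
  by have [c [Jc _]] := E_frame.2 p _ Up (tJ _ _ (tE j)); exists c.
pose A := \matrix_(j, k) a j 0 k.
have AA : A *m A = - 1%:M.
  apply/row_matrixP => j; apply: frame_inj; transitivity (- E j p).
    rewrite -(JJ p _ (tE j)) aE.
    rewrite (tangent_linear_sum (alpha := J p)) //; last first.
      by move=> b x y tx ty; exact: linJ.
    under [RHS]eq_bigr do rewrite aE scaler_sumr.
    rewrite exchange_big; apply: eq_bigr => k _ /=.
    rewrite 2!mxE scaler_suml; apply: eq_bigr => l _.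
    by rewrite !mxE scalerA.
  rewrite (bigD1 j) //= big1 ?addr0; first by rewrite !mxE eqxx scaleN1r.
  by move=> k /negbTE kj; rewrite !mxE eq_sym kj oppr0 scale0r.
rewrite -[RHS](mxtrace_sqrN1 AA) -[A in RHS](mulmxK gram_unit) mxtrace_mulC.
apply: eq_bigr => i _; rewrite mxE; apply: eq_bigr => j _; congr (_ * _).
rewrite aE (tangent_form_sum (alpha := g p (E i p))); last first.
  by move=> b x y tx ty; exact: metricPr.
by rewrite mxE; apply: eq_bigr => k _; rewrite gram_sym !mxE.
Qed.

End Frames.

(** * Conformal changes of Norden metrics *)

Section Norden.
Context {R : realType} {m : nat} {M : smoothManifold R m}.
Context {J : endo M} (J_ac : almost_complex J).
Context {g : form2 M} (g_met : pseudo_riemannian g) (Jg : norden J g).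
Implicit Types (p : M) (x y z : operator M) (nabla : connection M).

(** [J] is self-adjoint, unlike in the Hermitian case: in the Norden condition for [x] and [J y],
    the sign cancels the one from [J^2 = -1]. *)
Lemma norden_sym p x y : tangent p x -> tangent p y ->
  g p (J p x) y = g p x (J p y).
Proof.
have [[tJ _ _] JJ] := J_ac; move=> tx ty.
apply: oppr_inj; rewrite -(Jg tx (tJ _ _ ty)) JJ //.
have tJx := tJ _ _ tx; have tN : tangent p (- y).
  by rewrite -scaleN1r; exact: tangentZ.
rewrite (metricC g_met tJx tN) -[- y]scaleN1r (metricZl g_met) // mulN1r.
by rewrite (metricC g_met ty).
Qed.

(** The term added to [nabla] is smooth and linear over functions in both arguments, so the axioms
    pass from [nabla] to the sum. *)
Lemma connection0_is_connection nabla theta Omega :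
  is_connection nabla -> lie_form J g nabla theta ->
  lie_vector g theta Omega -> is_connection (connection0 J g nabla theta Omega).
Proof.
move=> cn [[lin_th smooth_th] _] [vO _]; have [[tJ linJ vJ] _] := J_ac.
have JD p x y : tangent p x -> tangent p y -> J p (x + y) = J p x + J p y.
  by move=> tx ty; rewrite -{1}[x]scale1r linJ // scale1r.
have thD p x y : tangent p x -> tangent p y ->
    theta p (x + y) = theta p x + theta p y.
  by move=> tx ty; rewrite -{1}[x]scale1r lin_th // mul1r.
have JZ p (c : R) x : tangent p x -> J p (c *: x) = c *: J p x.
  move=> tx; have t0 := tangent0 p; have := JD p 0 0 t0 t0.
  rewrite addr0 -{1}[J p 0]addr0 => /addrI J0.
  by rewrite -[c *: x]addr0 linJ // -J0 addr0.
have thZ p (c : R) x : tangent p x -> theta p (c *: x) = c * theta p x.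
  move=> tx; have t0 := tangent0 p; have := thD p 0 0 t0 t0.
  rewrite addr0 -{1}[theta p 0]addr0 => /addrI th0.
  by rewrite -[c *: x]addr0 lin_th // -th0 addr0.
have metricDr p x y z : tangent p x -> tangent p y -> tangent p z ->
    g p z (x + y) = g p z x + g p z y.
  by move=> tx ty tz; rewrite -{1}[x]scale1r (metricPr g_met) // mul1r.
have metricZr p c x z : tangent p x -> tangent p z ->
    g p z (c *: x) = c * g p z x.
  move=> tx tz; rewrite !(metricC g_met tz) ?(metricZl g_met) //.
  exact: tangentZ.
split=> [U X Y oU vX vY|U X X' Y oU vX vX' vY p Up|U f X Y oU fs vX vY p Up
        |U X Y Y' oU vX vY vY' p Up|U f X Y oU fs vX vY p Up];
  rewrite /connection0.
- apply: vector_fieldD; first exact: conn_field.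
  apply: (vector_fieldZ (f := cst (m%:R^-1))); first exact: smooth_on_cst.
  apply: vector_fieldB; apply: vector_fieldZ => //.
  + exact: smooth_th _ _ oU (vJ _ _ oU vY).
  + exact: smooth_metric.
  + exact: vJ oU (sub_vector_field (@subsetT _ U) vO).
- have [tX tX' tY] := And3 (vX.1 p Up) (vX'.1 p Up) (vY.1 p Up).
  rewrite (conn_addl cn oU vX vX' vY Up) (metricDl g_met) //.
  rewrite addrACA -scalerDr; congr (_ + _ *: _).
  by rewrite scalerDr scalerDl opprD addrACA.
- have [tX tY] := conj (vX.1 p Up) (vY.1 p Up).
  rewrite (conn_scalel cn oU fs vX vY Up) (metricZl g_met) //.
  rewrite [RHS]scalerDr; congr (_ + _).
  rewrite [RHS]scalerA (mulrC (f p) m%:R^-1) -[RHS]scalerA; congr (_ *: _).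
  by rewrite scalerBr !scalerA (mulrC (f p) (theta _ _)).
- have [tX tY tY'] := And3 (vX.1 p Up) (vY.1 p Up) (vY'.1 p Up).
  rewrite (conn_addr cn oU vX vY vY' Up) metricDr // JD //.
  rewrite (thD _ _ _ (tJ _ _ tY) (tJ _ _ tY')).
  rewrite addrACA -scalerDr; congr (_ + _ *: _).
  by rewrite !scalerDl opprD addrACA.
- have [tX tY] := conj (vX.1 p Up) (vY.1 p Up).
  rewrite (conn_leibniz cn oU fs vX vY Up) metricZr // JZ //.
  rewrite (thZ _ _ _ (tJ _ _ tY)).
  rewrite [f p *: (_ + _)]scalerDr -addrA; congr (_ + (_ + _)).
  rewrite [RHS]scalerA (mulrC (f p) m%:R^-1) -[RHS]scalerA; congr (_ *: _).
  by rewrite scalerBr !scalerA.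
Qed.

(** * Lie forms and natural connections under a conformal change *)

Context {nabla nablab : connection M} {u : M -> R}.
Context (nabla_lc : levi_civita g nabla).
Context (nablab_lc : levi_civita (conformal u g) nablab).
Context (u_smooth : smooth_on setT u).

(** Moving [J] to the last argument makes [F] a difference of two products covered by the Koszul
    formula; self-adjointness of [J] cancels the terms in [du(X)]. *)
Lemma tensorF_conformal U X Y Z p : open U ->
  vector_field U X -> vector_field U Y -> vector_field U Z -> U p ->
  tensorF J (conformal u g) nablab X Y Z p =
  expR (2 * u p) * (tensorF J g nabla X Y Z p +
    (J p (Y p) u * g p (X p) (Z p) - Z p u * g p (X p) (J p (Y p)) -
     Y p u * g p (X p) (J p (Z p)) + J p (Z p) u * g p (X p) (Y p))).
Proof.
move=> oU vX vY vZ Up; have [[tJ _ vJ] _] := J_ac.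
have [cn _ _] := nabla_lc; have [cb _ _] := nablab_lc.
have [vJY vJZ] := conj (vJ _ _ oU vY) (vJ _ _ oU vZ).
rewrite /tensorF /conformal; congr (_ * _).
have tY := vY.1 p Up; have tZ := vZ.1 p Up.
have tnY := (conn_field cn oU vX vY).1 p Up.
have tbY := (conn_field cb oU vX vY).1 p Up.
have tnJY := (conn_field cn oU vX vJY).1 p Up.
have tbJY := (conn_field cb oU vX vJY).1 p Up.
rewrite !(metricBl g_met) ?norden_sym //; try exact: tJ.
have koszul := conformal_levi_civita g_met nabla_lc nablab_lc u_smooth oU.
rewrite (koszul _ _ _ vX vJY vZ p Up) (koszul _ _ _ vX vY vJZ p Up).
rewrite /app_endo norden_sym //; ring.
Qed.

Lemma lie_form_conformal theta thetab p z :
  lie_form J g nabla theta -> lie_form J (conformal u g) nablab thetab ->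
  tangent p z -> thetab p z = theta p z + m%:R * J p z u.
Proof.
move=> [_ thE] [_ thbE] tz; have [[tJ linJ _] JJ] := J_ac.
have [i di] := chart_cover p; have [a za] := tangent_chart di tz.
have oi : open (chart_dom i) by exact: chart_dom_open.
have frE := chart_frame_local_frame (M := M) i.
have vZ : vector_field (chart_dom i) (chart_vector i a).
  exact: chart_vector_field.
have tE j : tangent p (chart_frame i j p) by exact: (frE.1 j).1.
pose G := gram g (chart_frame i) p.
have Gu : G \in unitmx := gram_unit g_met frE di.
have e0 : expR (2 * u p) != 0 by exact/lt0r_neq0/expR_gt0.
have Gc : gram (conformal u g) (chart_frame i) p = expR (2 * u p) *: G.
  by apply/matrixP => j k; rewrite !mxE.
have eGu : expR (2 * u p) *: G \in unitmx.
  by rewrite unitmxZ // unitfE.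
rewrite za (thbE _ _ _ oi frE vZ p di) (thE _ _ _ oi frE vZ p di) Gc invmxZ //.
rewrite -/G -za.
pose S j k := J p (chart_frame i k p) u * g p (chart_frame i j p) z -
  z u * g p (chart_frame i j p) (J p (chart_frame i k p)) -
  chart_frame i k p u * g p (chart_frame i j p) (J p z) +
  J p z u * g p (chart_frame i j p) (chart_frame i k p).
(* The factor [e^(2u)] of [F] cancels the [e^(-2u)] of the inverse Gram matrix. *)
transitivity (\sum_j \sum_k (invmx G j k *
    tensorF J g nabla (chart_frame i j) (chart_frame i k) (chart_vector i a) p
    + invmx G j k * S j k)).
  apply: eq_bigr => j _; apply: eq_bigr => k _.
  rewrite (tensorF_conformal oi (frE.1 j) (frE.1 k) vZ di) -za mxE.
  by rewrite mulrACA mulVf // mul1r mulrDr.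
under eq_bigr do rewrite big_split /=.
rewrite big_split /=; congr (_ + _).
pose T (h : 'I_m -> 'I_m -> R) := \sum_j \sum_k invmx G j k * h j k.
pose h1 j k := J p (chart_frame i k p) u * g p (chart_frame i j p) z.
pose h2 j k := g p (chart_frame i j p) (J p (chart_frame i k p)).
pose h3 j k := chart_frame i k p u * g p (chart_frame i j p) (J p z).
pose h4 j k := g p (chart_frame i j p) (chart_frame i k p).
have s1 : T h1 = J p z u.
  apply: (contract_form g_met frE di (alpha := fun x => J p x u)) => //.
  by move=> b x y tx ty; rewrite linJ.
have s2 : T h2 = 0 := contract_almost_complex g_met frE di J_ac.
have s3 : T h3 = J p z u.
  apply: (contract_form g_met frE di (alpha := fun x => x u)) => //.
  exact: tJ.
have s4 : T h4 = m%:R := contract_metric g_met frE di.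
transitivity (T h1 - z u * T h2 - T h3 + J p z u * T h4); last first.
  by rewrite s1 s2 s3 s4; ring.
rewrite /T !mulr_sumr -!sumrB -big_split; apply: eq_bigr => j _ /=.
rewrite !mulr_sumr -!sumrB -big_split; apply: eq_bigr => k _ /=.
by rewrite /S /h1 /h2 /h3 /h4; ring.
Qed.

Lemma connection0_conformal theta thetab Omega Omegab : (0 < m)%N ->
  lie_form J g nabla theta -> lie_form J (conformal u g) nablab thetab ->
  lie_vector g theta Omega -> lie_vector (conformal u g) thetab Omegab ->
  forall U X Y, open U -> vector_field U X -> vector_field U Y ->
  forall p, U p ->
    connection0 J (conformal u g) nablab thetab Omegab X Y p =
    connection0 J g nabla theta Omega X Y p + X p u *: Y p.
Proof.
move=> m0 th thb [vO OE] [vOb ObE] U X Y oU vX vY p Up.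
have [[tJ linJ vJ] JJ] := J_ac.
have [cn _ _] := nabla_lc; have [cb _ _] := nablab_lc.
have tX := vX.1 p Up; have tY := vY.1 p Up.
have tn := (conn_field cn oU vX vY).1 p Up.
have tb := (conn_field cb oU vX vY).1 p Up.
have tO := vO.1 p I; have tOb := vOb.1 p I.
have tJO := tJ _ _ tO; have tJOb := tJ _ _ tOb; have tJY := tJ _ _ tY.
have mn0 : m%:R != 0 :> R by rewrite pnatr_eq0 -lt0n.
have tc (c c' : R) (o : operator M) : tangent p o ->
    tangent p (m%:R^-1 *: (c *: X p - c' *: o)).
  by move=> to; exact: tangentZ (tangentB (tangentZ _ tX) (tangentZ _ to)).
have tD : tangent p (connection0 J g nabla theta Omega X Y p).
  exact: tangentD tn (tc _ _ _ tJO).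
have tDu := tangentD tD (tangentZ (X p u) tY).
apply: (metric_eq g_met (tangentD tb (tc _ _ _ tJOb)) tDu) => z tz.
(* The Koszul formula takes fields, so [z] is extended and everything is restricted to [U] and [V]
   together. *)
have [V [Z [oV Vp vZ Zp]]] := tangent_extend tz; have tJz := tJ _ _ tz.
have UVp : (U `&` V) p by [].
have oUV := openI oU oV.
have k := conformal_levi_civita g_met nabla_lc nablab_lc u_smooth oUV
  (sub_vector_field (@subIsetl _ U V) vX)
  (sub_vector_field (@subIsetl _ U V) vY)
  (sub_vector_field (@subIsetr _ U V) vZ) UVp.
rewrite Zp in k.
have OJ : g p (J p (Omega p)) z = theta p (J p z).
  by rewrite norden_sym // (metricC g_met tO tJz) OE.
(* The relation between [J Omegab] and [J Omega], paired with [z]; the minus sign is [J^2 = -1]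
   applied in [du(J (J z))]. *)
have ObJ : expR (2 * u p) * g p (J p (Omegab p)) z =
    theta p (J p z) - m%:R * z u.
  rewrite norden_sym // (metricC g_met tOb tJz).
  rewrite -[LHS]/(conformal u g p (J p z) (Omegab p)) -ObE //.
  by rewrite (lie_form_conformal th thb tJz) JJ // -[(- z) u]/(- z u) mulrN.
have gE (c c' : R) (v o : operator M) : tangent p v -> tangent p o ->
    g p (v + m%:R^-1 *: (c *: X p - c' *: o)) z =
    g p v z + m%:R^-1 * (c * g p (X p) z - c' * g p o z).
  move=> tv to; have tco := tc c c' o to; rewrite (metricDl g_met) //.
  rewrite (metricZl g_met) ?(metricBl g_met) ?(metricZl g_met) //.
  - exact: tangentZ.
  - exact: tangentZ.
  - exact: tangentB (tangentZ _ tX) (tangentZ _ to).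
rewrite (metricDl g_met tD (tangentZ _ tY) tz) (metricZl g_met _ tY tz).
rewrite /connection0 !gE //.
rewrite OJ k (lie_form_conformal th thb tJY) JJ // -[(- Y p) u]/(- Y p u).
have -> : conformal u g p (X p) (Y p) * g p (J p (Omegab p)) z =
    g p (X p) (Y p) * (theta p (J p z) - m%:R * z u).
  by rewrite -ObJ /conformal; ring.
by field.
Qed.

End Norden.

Theorem theorem4p1 (R : realType) (n : nat) (n_gt0 : (0 < n)%N)
    (M : smoothManifold R (2 * n))
    (J : endo M) (g : form2 M)
    (nabla : connection M) (theta : form1 M) (Omega : section M)
    (J_ac : almost_complex J)
    (g_met : pseudo_riemannian g)
    (Jg : norden J g)
    (nabla_lc : levi_civita g nabla)
    (theta_lie : lie_form J g nabla theta)
    (Omega_lie : lie_vector g theta Omega)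
    (M_W1 : W1 J g nabla theta)
    (thetastar_closed : closed_form1 (form1_endo theta J))
    (u : M -> R) (u_ph : pluriharmonic J u)
    (nablab : connection M) (thetab : form1 M) (Omegab : section M)
    (nablab_lc : levi_civita (conformal u g) nablab)
    (thetab_lie : lie_form J (conformal u g) nablab thetab)
    (Omegab_lie : lie_vector (conformal u g) thetab Omegab) :
  forall (U : set M) (X Y Z W : section M), open U ->
    vector_field U X -> vector_field U Y ->
    vector_field U Z -> vector_field U W ->
  forall p, U p ->
    curvature04 (conformal u g)
      (connection0 J (conformal u g) nablab thetab Omegab) X Y Z W p =
    expR (2 * u p) *
    curvature04 g (connection0 J g nabla theta Omega) X Y Z W p.
Proof.
have [u_smooth _] := u_ph; have [cn tn _] := nabla_lc.
move=> U X Y Z W oU vX vY vZ vW p Up.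
(* Stripping the factor of the lowered index leaves the equality of the two curvature operators. *)
rewrite /curvature04 /app_form2 /conformal; congr (_ * g p _ _).
apply: (@curvature_add_differential _ _ _ _ _ u _ _ _ _ U) => //.
- exact: connection0_is_connection cn theta_lie Omega_lie.
(* [nabla^0] has torsion in general, so brackets are controlled through [nabla]. *)
- by move=> V X' Y' oV vX' vY'; exact: (torsion_free_bracket cn tn oV).
- by apply: connection0_conformal => //; rewrite muln_gt0.
Qed.
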